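(* For each integer $n \ge 2$, there is a bijection $C_{12}(n) \cong C_{\hat{1}}(n) \sqcup C_o(n)$, where $\sqcup$ denotes the disjoint union (a composition lying in both $C_{\hat{1}}(n)$ and $C_o(n)$ is counted twice, once for each set).
   Context: Given a positive integer $n$, a composition of $n$ is an ordered collection (finite sequence) of positive integers, called parts, whose sum is $n$; different orders count as different compositions. $C_{12}(n)$ denotes the set of compositions of $n$ all of whose parts belong to $\{1,2\}$; $C_{\hat{1}}(n)$ denotes the set of compositions of $n$ all of whose parts are at least two; $C_o(n)$ denotes the set of compositions of $n$ all of whose parts are odd. The sets $C_{\hat{1}}(n)$ and $C_o(n)$ are not necessarily disjoint as sets of compositions. *)

(* Defs.v *)
From mathcomp Require Import all_boot.

Set Implicit Arguments.
Unset Strict Implicit.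
Unset Printing Implicit Defensive.

Definition composition (n : nat) : {pred seq nat} :=
  [pred c | all (fun p => 0 < p) c && (sumn c == n)].

Definition C12 (n : nat) : {pred seq nat} :=
  [pred c | (c \in composition n) && all (fun p => p \in [:: 1; 2]) c].

Definition C1hat (n : nat) : {pred seq nat} :=
  [pred c | (c \in composition n) && all (fun p => 2 <= p) c].

Definition Co (n : nat) : {pred seq nat} :=
  [pred c | (c \in composition n) && all odd c].

(* Main.v *)
Require Import Defs.
From mathcomp Require Import all_boot.

(** Cut a nonempty word over {1,2} just before each occurrence of its own first
letter, and replace each block by its sum.

A word that begins with 1 is cut into blocks 1 2 2 ... 2, whose sums are the odd
numbers; since 1 + 2k determines k, each odd number is the sum of exactly one
such block, so these words correspond to compositions into odd parts.  A word
that begins with 2 is cut into blocks 2 1 1 ... 1, whose sums are the integers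
at least 2, again each obtained exactly once, so these words correspond to
compositions into parts at least 2.  As n > 0, every word has a first letter,
and this letter says which of the two summands the word belongs to; a
composition lying in both sets is therefore reached from two different words.

Both cases are instances of one construction, for letters a (the first letter of
a block) and b (the repeated one).  The lemmas [spellK] and [groupK] say that
replacing block sums by blocks, and blocks by block sums, are mutually inverse. *)

(** [block_sum a b p] recognises the sums of blocks a b b ... b. *)
Definition block_sum (a b p : nat) : bool := (a <= p) && (b %| p - a).

Definition block (a b p : nat) : seq nat := a :: nseq ((p - a) %/ b) b.

Definition spell (a b : nat) (c : seq nat) : seq nat :=
  flatten [seq block a b p | p <- c].

(** The accumulator [p] is the sum of the part already read of the current
block, which a letter [a] or the end of the word closes. *)
Fixpoint gather (a p : nat) (w : seq nat) : seq nat :=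
  if w is x :: w' then
    if x == a then p :: gather a a w' else gather a (p + x) w'
  else [:: p].

(** The first letter of the word is taken to be [a]: it opens the first block. *)
Definition group (a : nat) (w : seq nat) : seq nat :=
  if w is _ :: w' then gather a a w' else [::].

Lemma block_sum_odd p : block_sum 1 2 p = odd p.
Proof. by case: p => [|p] //; rewrite /block_sum subn1 dvdn2. Qed.

Lemma block_sum_ge2 p : block_sum 2 1 p = (2 <= p).
Proof. by rewrite /block_sum dvd1n andbT. Qed.

Lemma block_sum_first a b : block_sum a b a.
Proof. by rewrite /block_sum leqnn subnn dvdn0. Qed.

Lemma block_sum_extend a b p : block_sum a b p -> block_sum a b (p + b).
Proof.
by case/andP=> ap bp; rewrite /block_sum (leq_trans ap) ?leq_addr //= -addnBAC // dvdn_addl.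
Qed.

Lemma block_extend a b p : 0 < b -> block_sum a b p ->
  block a b (p + b) = rcons (block a b p) b.
Proof.
move=> b_gt0 /andP[ap _].
by rewrite /block /= -addnBAC // divnDr ?dvdnn // divnn b_gt0 nseqD -cats1.
Qed.

Lemma sumn_block a b p : block_sum a b p -> sumn (block a b p) = p.
Proof. by case/andP=> ap bp; rewrite /= sumn_nseq mulnC divnK // subnKC. Qed.

Lemma spell_cons a b p c : spell a b (p :: c) = block a b p ++ spell a b c.
Proof. by []. Qed.

Lemma sumn_spell a b c : all (block_sum a b) c -> sumn (spell a b c) = sumn c.
Proof.
elim: c => [|p c IHc] // /andP[bp bc].
by rewrite spell_cons sumn_cat sumn_block // IHc.
Qed.

Lemma spell_letters a b c : all (fun x => x \in [:: a; b]) (spell a b c).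
Proof.
rewrite /spell; elim: c => [|p c IHc] //=.
by rewrite all_cat IHc all_nseq !inE !eqxx !orbT.
Qed.

Lemma sumn_gather a p w : sumn (gather a p w) = p + sumn w.
Proof.
elim: w p => [|x w IHw] p //=.
by case: eqP => [->|_] /=; rewrite IHw ?addnA.
Qed.

Lemma gather_block_sum a b p w : block_sum a b p ->
  all (fun x => x \in [:: a; b]) w -> all (block_sum a b) (gather a p w).
Proof.
elim: w p => [|x w IHw] p bp /=; first by rewrite bp.
rewrite !inE; case: eqP => /= [_ wab|_ /andP[/eqP-> wab]].
  by rewrite bp IHw // block_sum_first.
by rewrite IHw // block_sum_extend.
Qed.

Lemma gather_nseq a b p k w : b != a ->
  gather a p (nseq k b ++ w) = gather a (p + k * b) w.
Proof.
move=> /negPf ba; elim: k p => [|k IHk] p /=; first by rewrite addn0.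
by rewrite ba IHk mulSn addnA.
Qed.

Lemma spellK a b c : b != a -> all (block_sum a b) c ->
  group a (spell a b c) = c.
Proof.
move=> ba; rewrite /spell; elim: c => [|p c IHc] //= /andP[/andP[ap bp] bc].
rewrite gather_nseq // divnK // subnKC //.
(* What follows the first block is empty or begins with [a], which closes it. *)
by case: c IHc bc => [|q c] //= IHc bc; rewrite eqxx IHc.
Qed.

(** The accumulator stands for the block that it is the sum of. *)
Lemma spell_gather a b p w : 0 < b -> block_sum a b p ->
  all (fun x => x \in [:: a; b]) w ->
  spell a b (gather a p w) = block a b p ++ w.
Proof.
move=> b_gt0; elim: w p => [|x w IHw] p bp; first by [].
rewrite [all _ _]/= !inE [gather _ _ _]/=.
case: eqP => /= [-> wab|_ /andP[/eqP-> wab]].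
  by rewrite spell_cons IHw ?block_sum_first // /block subnn div0n.
by rewrite IHw ?block_sum_extend // block_extend // cat_rcons.
Qed.

Lemma groupK a b w : 0 < b -> all (fun x => x \in [:: a; b]) w ->
  spell a b (group a (a :: w)) = a :: w.
Proof.
by move=> b_gt0 wab; rewrite /= spell_gather ?block_sum_first // /block subnn div0n.
Qed.

Lemma C12E n c :
  (c \in C12 n) = all (fun p => p \in [:: 1; 2]) c && (sumn c == n).
Proof.
rewrite !inE andbAC; congr (_ && _); apply: andb_idl.
by apply: sub_all => -[].
Qed.

Lemma C1hatE n c : (c \in C1hat n) = all (block_sum 2 1) c && (sumn c == n).
Proof.
rewrite !inE (eq_all block_sum_ge2) andbAC; congr (_ && _); apply: andb_idl.
by apply: sub_all => -[].
Qed.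

Lemma CoE n c : (c \in Co n) = all (block_sum 1 2) c && (sumn c == n).
Proof.
rewrite !inE (eq_all block_sum_odd) andbAC; congr (_ && _); apply: andb_idl.
by apply: sub_all => -[].
Qed.

Lemma letters21 w :
  all (fun x => x \in [:: 2; 1]) w = all (fun x => x \in [:: 1; 2]) w.
Proof. by apply: eq_all => x; rewrite !inE orbC. Qed.

Lemma spell_C1hat n c : c \in C1hat n -> spell 2 1 c \in C12 n.
Proof.
by rewrite C1hatE C12E -letters21 spell_letters => /andP[bc]; rewrite sumn_spell.
Qed.

Lemma spell_Co n c : c \in Co n -> spell 1 2 c \in C12 n.
Proof. by rewrite CoE C12E spell_letters => /andP[bc]; rewrite sumn_spell. Qed.

Lemma group_C1hat n w : 2 :: w \in C12 n -> group 2 (2 :: w) \in C1hat n.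
Proof.
rewrite C12E C1hatE /= => /andP[wab sw].
by rewrite gather_block_sum ?block_sum_first ?letters21 // sumn_gather.
Qed.

Lemma group_Co n w : 1 :: w \in C12 n -> group 1 (1 :: w) \in Co n.
Proof.
rewrite C12E CoE /= => /andP[wab sw].
by rewrite gather_block_sum ?block_sum_first // sumn_gather.
Qed.

Lemma bijective_of_inj_surj (S T : choiceType) (g : S -> T) :
  injective g -> (forall y, exists x, g x == y) ->
  exists f : T -> S, bijective f.
Proof.
move=> g_inj g_surj; pose f y := xchoose (g_surj y).
have fK y : g (f y) = y by apply/eqP; apply: (xchooseP (g_surj y)).
by exists f; exists g => // x; apply: g_inj.
Qed.

Theorem theorem4 (n : nat) (hn : 2 <= n) :
  exists f : {c : seq nat | c \in C12 n} ->
             {c : seq nat | c \in C1hat n} + {c : seq nat | c \in Co n},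
    bijective f.
Proof.
pose g (s : {c | c \in C1hat n} + {c | c \in Co n}) : {c | c \in C12 n} :=
  match s with
  | inl u => exist (fun c => c \in C12 n) _ (spell_C1hat _ _ (svalP u))
  | inr u => exist (fun c => c \in C12 n) _ (spell_Co _ _ (svalP u))
  end.
apply: (@bijective_of_inj_surj _ _ g).
- (* The empty composition is excluded since [n] is positive; hence a spelled
     word has a first letter, which tells the two summands apart. *)
  case=> [[c hc]|[c hc]] [[d hd]|[d hd]] /(congr1 val) /=.
  + move=> /(congr1 (group 2)).
    have:= hc; have:= hd; rewrite !C1hatE => /andP[bd _] /andP[bc _].
    rewrite !spellK // => cd.
    by congr inl; apply: val_inj.
  + move: hc hd; case: c => [|p c] hc; case: d => [|q d] hd //.
    by exfalso; move: (hc) (hn); rewrite C1hatE => /andP[_ /eqP<-].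
  + move: hc hd; case: c => [|p c] hc; case: d => [|q d] hd //.
    by exfalso; move: (hc) (hn); rewrite CoE => /andP[_ /eqP<-].
  + move=> /(congr1 (group 1)).
    have:= hc; have:= hd; rewrite !CoE => /andP[bd _] /andP[bc _].
    rewrite !spellK // => cd.
    by congr inr; apply: val_inj.
- case=> -[|x w] hw; first by exfalso; move: (hw) (hn); rewrite C12E => /andP[_ /eqP<-].
  have /andP[/andP[]] : all (fun x => x \in [:: 1; 2]) (x :: w) && (sumn (x :: w) == n).
    by rewrite -C12E.
  rewrite !inE => /orP[/eqP x1|/eqP x2] wab _; subst x.
  + exists (inr (exist (fun c => c \in Co n) _ (group_Co _ _ hw))).
    by rewrite -val_eqE /=; apply/eqP; apply: groupK.
  + exists (inl (exist (fun c => c \in C1hat n) _ (group_C1hat _ _ hw))).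
    by rewrite -val_eqE /=; apply/eqP; apply: groupK; rewrite ?letters21.
Qed.
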